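(* Let $S\subseteq\mathbb{R}^s$ be an open set and let $f=(f_1,\dots,f_n):S\to\mathbb{R}^n$ be Fréchet differentiable on $S$. Then the following two statements are equivalent: (i) for every vector critical point $(x,\lambda)$ of $f$ (that is, every vector critical point $x\in S$ with a respective multiplier $\lambda$), the point $x$ is a global solution of the weighting problem $(\mathrm{P}_\lambda)$ with the same vector $\lambda$; (ii) $f$ is invex on $S$.
   Context: For vectors $a,b\in\mathbb{R}^n$: $a\leqq b$ means $a_i\le b_i$ for all $i$, and $a\geqq b$ means $b\leqq a$. The Jacobian matrix of $f$ at $x$ is $Jf(x)$, an $n\times s$ matrix with rows $\nabla f_i(x)$; for $\lambda\in\mathbb{R}^n$, $\lambda\,Jf(x)=\sum_{i=1}^n\lambda_i\nabla f_i(x)$, and $\lambda f(x)=\sum_{i=1}^n\lambda_i f_i(x)$. The vector problem (P) is: minimize $f(x)$ subject to $x\in S$. Vector critical point: a pair $(\bar x,\bar\lambda)\in S\times\mathbb{R}^n$ such that $\bar\lambda\geqq 0$, $\bar\lambda\neq 0$ and $\bar\lambda\,Jf(\bar x)=0$; $\bar\lambda$ is called a respective multiplier of $\bar x$. Weighting problem $(\mathrm{P}_\lambda)$, for $\lambda\geqq 0$, $\lambda\ne 0$: minimize $\lambda f(x)$ subject to $x\in S$. A point $\bar x\in S$ is a global solution if $\lambda f(\bar x)\le\lambda f(x)$ for all $x\in S$. Invex: $f$ is invex if for all $x,y\in S$ there exists a vector $\eta(x,y)\in\mathbb{R}^s$ (depending on $x$ and $y$) such that $f(y)-f(x)\geqq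 Jf(x)\,\eta(x,y)$. *)

(* Defs.v *)
From mathcomp Require Import all_boot all_order all_algebra.
From mathcomp Require Import all_classical all_reals all_analysis.
Set Implicit Arguments.
Unset Strict Implicit.
Unset Printing Implicit Defensive.
Import Order.TTheory GRing.Theory Num.Theory.
Import numFieldNormedType.Exports.
Local Open Scope classical_set_scope.
Local Open Scope ring_scope.

(* Points and multipliers are row vectors. A map on S is a total function of
   which only the behaviour on S is used: S being open, differentiability and
   the Jacobian at a point of S do not depend on the values outside S. *)

Definition vec_le (R : realType) (n : nat) (a b : 'rV[R]_n) : Prop :=
  forall i : 'I_n, a 0 i <= b 0 i.

(* ['J f x] acts on row vectors on the right, ['d f x v = v *m 'J f x], so its
   columns are the gradients; the n x s Jacobian matrix with rows grad f_i(x)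
   is its transpose. *)
Definition Jmat (R : realType) (s n : nat) (f : 'rV[R]_s -> 'rV[R]_n)
    (x : 'rV[R]_s) : 'M[R]_(n, s) :=
  ('J f x)^T.

Definition vector_critical_point (R : realType) (s n : nat)
    (S : set 'rV[R]_s) (f : 'rV[R]_s -> 'rV[R]_n)
    (x : 'rV[R]_s) (l : 'rV[R]_n) : Prop :=
  [/\ S x, vec_le 0 l, l <> 0 & l *m Jmat f x = 0].

Definition weighted (R : realType) (s n : nat) (l : 'rV[R]_n)
    (f : 'rV[R]_s -> 'rV[R]_n) (x : 'rV[R]_s) : R :=
  \sum_(i < n) l 0 i * f x 0 i.

Definition weighting_global_solution (R : realType) (s n : nat)
    (S : set 'rV[R]_s) (f : 'rV[R]_s -> 'rV[R]_n)
    (l : 'rV[R]_n) (x : 'rV[R]_s) : Prop :=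
  S x /\ forall y : 'rV[R]_s, S y -> weighted l f x <= weighted l f y.

(* The row [eta *m (Jmat f x)^T] is the vector Jf(x) eta. *)
Definition invex (R : realType) (s n : nat)
    (S : set 'rV[R]_s) (f : 'rV[R]_s -> 'rV[R]_n) : Prop :=
  forall x y : 'rV[R]_s, S x -> S y ->
    exists eta : 'rV[R]_s, vec_le (eta *m (Jmat f x)^T) (f y - f x).

(* Main.v *)
Require Import Defs.
From mathcomp Require Import all_boot all_order all_algebra.
From mathcomp Require Import all_classical all_reals all_analysis.
Import Order.TTheory GRing.Theory Num.Theory.
Import numFieldNormedType.Exports.
Local Open Scope classical_set_scope.
Local Open Scope ring_scope.

(** Fix [x] and [y] in [S].  Invexity at this pair says that the finite system
    of affine inequalities [Jf(x) eta <= f(y) - f(x)] in the unknown [eta] is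
    solvable.  By Gale's theorem of the alternative ([gale]), it fails to be
    solvable exactly when some [l >= 0] satisfies [l Jf(x) = 0] and
    [l (f(y) - f(x)) < 0].  Such an [l] is nonzero because of the strict
    inequality, so [(x, l)] is a vector critical point, and [y] shows that [x]
    does not minimize the weighted objective [l f]: this contradicts (i).
    Conversely, multiplying the invexity inequality by the multiplier [l >= 0]
    of a critical point gives [l f(y) - l f(x) >= l Jf(x) eta = 0].

    The equivalence is thus linear algebra applied separately to each pair of
    points; the only real ingredient is Gale's theorem, which follows by
    homogenization from Farkas' lemma ([farkas]). *)

(** Induction on the number of inequalities (Bartl's argument).  If the
    inequalities other than the first, [x alpha <= 0], already force [x c <= 0],
    the first one gets multiplier 0.  Otherwise some [x0] satisfies all the
    others and has [x0 c > 0]; it must violate the first, and is scaled to have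
    [x0 alpha = 1].  Projecting along [x0] onto the hyperplane [x alpha = 0]
    eliminates the first inequality and yields multipliers [mu] for the others;
    [c - B mu] then vanishes on that hyperplane, so it is [alpha] times the
    coefficient [x0 (c - B mu)], which is nonnegative by the choice of [x0]. *)
Lemma farkas (F : realFieldType) (k n : nat) (A : 'M[F]_(k, n)) (c : 'cV[F]_k) :
  (forall x : 'rV[F]_k, (forall i, (x *m A) 0 i <= 0) -> (x *m c) 0 0 <= 0) ->
  exists2 l : 'cV[F]_n, (forall i, 0 <= l i 0) & A *m l = c.
Proof.
elim: n A c => [|n IH] A c Ac.
  exists 0 => [[]//|]; rewrite mulmx0.
  (* Taking [x] to be the transpose of [c] bounds the sum of the squares of the
     entries of [c] by zero. *)
  have : (c^T *m c) 0 0 == 0.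
    rewrite eq_le Ac => [|[]//].
    by rewrite mxE sumr_ge0 // => i _; rewrite mxE -expr2 sqr_ge0.
  rewrite mxE psumr_eq0 => [/allP cc|i _]; last by rewrite mxE -expr2 sqr_ge0.
  apply/matrixP => i j; rewrite ord1 !mxE; apply/esym/eqP.
  by have := cc i (mem_index_enum i); rewrite mxE mulf_eq0 orbb.
rewrite -[A](@hsubmxK _ k 1 n) in Ac *.
move: (lsubmx _) (rsubmx _) Ac => alpha B Ac.
have row_mx_le0 (x : 'rV[F]_k) : (x *m alpha) 0 0 <= 0 ->
    (forall i, (x *m B) 0 i <= 0) ->
    forall i, (x *m (row_mx alpha B : 'M[F]_(k, 1 + n))) 0 i <= 0.
  move=> xa xB i; rewrite mul_mx_row; case: (@split_ordP 1 n i) => j ->.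
    by rewrite row_mxEl ord1.
  by rewrite row_mxEr.
have [Bc|] := pselect (forall x : 'rV[F]_k,
    (forall i, (x *m B) 0 i <= 0) -> (x *m c) 0 0 <= 0).
  have [mu mu0 Bmu] := IH B c Bc.
  exists (col_mx (0 : 'cV[F]_1) mu) => [i|].
    case: (@split_ordP 1 n i) => j ->; last by rewrite (@col_mxEd _ 1 n).
    by rewrite (@col_mxEu _ 1 n) mxE.
  by rewrite (@mul_row_col _ _ 1 n) mulmx0 add0r.
move=> /existsNP[x1 /not_implyP[x1B /negP]]; rewrite -ltNge => x1c.
have x1a : 0 < (x1 *m alpha) 0 0.
  by rewrite ltNge; apply/negP => /row_mx_le0/(_ x1B)/Ac; rewrite leNgt x1c.
pose x0 := ((x1 *m alpha) 0 0)^-1 *: x1.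
have x0a : x0 *m alpha = 1%:M.
  by rewrite -scalemxAl [x1 *m alpha]mx11_scalar -mul_scalar_mx -scalar_mxM
     mxE eqxx mulr1n mulVf ?gt_eqF.
have x0B i : (x0 *m B) 0 i <= 0.
  by rewrite -scalemxAl mxE pmulr_rle0 ?invr_gt0.
have x0c : 0 < (x0 *m c) 0 0 by rewrite -scalemxAl mxE mulr_gt0 ?invr_gt0.
(* [x *m P] is [x - (x alpha) x0], the projection of [x] along [x0]. *)
pose P : 'M[F]_k := 1%:M - alpha *m x0.
have Pa : P *m alpha = 0.
  by rewrite mulmxBl mul1mx -mulmxA x0a mulmx1 subrr.
have [x xPB|mu mu0 Bmu] := IH (P *m B) (P *m c).
  rewrite mulmxA; apply: Ac; apply: row_mx_le0 => [|i].
    by rewrite -mulmxA Pa mulmx0 mxE.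
  by rewrite -mulmxA.
exists (col_mx (x0 *m (c - B *m mu)) mu) => [i|].
  case: (@split_ordP 1 n i) => j ->; last by rewrite (@col_mxEd _ 1 n).
  rewrite (@col_mxEu _ 1 n) ord1.
  rewrite mulmxBr mulmxA mxE addr_ge0 ?(ltW x0c) // mxE oppr_ge0 mxE.
  by apply: sumr_le0 => i' _; rewrite mulr_le0_ge0.
rewrite (@mul_row_col _ _ 1 n).
have : P *m (c - B *m mu) = 0 by rewrite mulmxBr mulmxA Bmu subrr.
rewrite mulmxBl mul1mx => /subr0_eq; rewrite -mulmxA => <-.
by rewrite subrK.
Qed.

(** Homogenization: if the system has no solution, the inequalities
    [x A - t b <= 0] in [(t, x)] force [t <= 0], because [x / t] would be a
    solution for [t > 0].  Farkas' lemma then writes the linear form [t] as a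
    nonnegative combination of these inequalities, and comparing coefficients
    gives [A l = 0] and [b l = -1]. *)
Lemma gale (F : realFieldType) (k n : nat) (A : 'M[F]_(k, n)) (b : 'rV[F]_n) :
  (exists x : 'rV[F]_k, forall i, (x *m A) 0 i <= b 0 i) \/
  (exists l : 'cV[F]_n,
    [/\ forall i, 0 <= l i 0, A *m l = 0 & (b *m l) 0 0 < 0]).
Proof.
have [|nosol] := pselect (exists x : 'rV[F]_k, forall i, (x *m A) 0 i <= b 0 i).
  by left.
right; have [z|l l0] := @farkas F (1 + k) n (col_mx (- b) A) (col_mx 1%:M 0).
  rewrite -[z]hsubmxK; move: (lsubmx z) (rsubmx z) => t x.
  rewrite !mul_row_col mulmx0 addr0 mulmx1 [t]mx11_scalar mul_scalar_mx.
  move: (t 0 0) => {}t tx; rewrite mxE eqxx mulr1n leNgt; apply/negP => t0.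
  apply: nosol; exists (t^-1 *: x) => i.
  rewrite -scalemxAl mxE ler_pdivrMl // -subr_le0 addrC.
  by have := tx i; rewrite scalerN !mxE.
rewrite mul_col_mx => /eq_col_mx[bl Al]; exists l; split => //.
move/matrixP: bl => /(_ 0 0); rewrite mulNmx !mxE => /eqP.
by rewrite eqr_oppLR => /eqP ->; rewrite oppr_lt0.
Qed.

Lemma weightedB (R : realType) (s n : nat) (l : 'rV[R]_n)
    (f : 'rV[R]_s -> 'rV[R]_n) (x y : 'rV[R]_s) :
  weighted l f y - weighted l f x = ((f y - f x) *m l^T) 0 0.
Proof.
rewrite /weighted -sumrB mxE; apply: eq_bigr => i _.
by rewrite !mxE mulrC mulrBl ![l _ _ * _]mulrC.
Qed.

Theorem theorem2 (R : realType) (s n : nat) (S : set 'rV[R]_s)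
    (f : 'rV[R]_s -> 'rV[R]_n)
    (S_open : open S)
    (f_diff : forall x : 'rV[R]_s, S x -> differentiable f x) :
  (forall (x : 'rV[R]_s) (l : 'rV[R]_n),
      vector_critical_point S f x l -> weighting_global_solution S f l x)
  <-> invex S f.
Proof.
split=> [crit x y Sx Sy|inv x l [Sx l0 _ lJ]].
  have [[eta etaP]|[l [l0 Jl bl]]] := gale _ _ _ ((Jmat f x)^T) (f y - f x).
    by exists eta.
  have [|_ /(_ y Sy)] := crit x l^T.
    split=> //.
    - by move=> i; rewrite !mxE.
    - move/(congr1 trmx); rewrite trmxK trmx0 => l00.
      by move: bl; rewrite l00 mulmx0 mxE ltxx.
    - by rewrite -[LHS]trmxK trmx_mul [l^T^T]trmxK Jl trmx0.
  by rewrite -subr_ge0 weightedB trmxK leNgt bl.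
split=> // y Sy; have [eta etaP] := inv x y Sx Sy.
rewrite -subr_ge0 weightedB.
have <- : (eta *m (Jmat f x)^T *m l^T) 0 0 = 0.
  by rewrite -mulmxA -trmx_mul lJ trmx0 mulmx0 mxE.
rewrite mxE [leRHS]mxE; apply: ler_sum => i _.
by rewrite ler_wpM2r // mxE; have := l0 i; rewrite mxE.
Qed.
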